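(* Let $\cong$ be a congruence on LTSs such that $L\doteq L'$ implies $L\cong L'$, and $\cong$ preserves $\mathit{Sf}$, $\mathit{Div}$ and $\mathit{aenI}$ but does not preserve $\mathit{Inf}$. Then $\cong$ is the equivalence induced by $\Sigma$, $\mathit{Sf}$, $\mathit{Div}$ and $\mathit{aenI}$.
   Context: An LTS is a tuple $L=(S,\Sigma,\Delta,\hat s)$ with states $S$, alphabet $\Sigma$ (possibly infinite), $\tau\notin\Sigma$ a reserved invisible action, transitions $\Delta\subseteq S\times(\Sigma\cup\{\tau\})\times S$, initial state $\hat s$; $\Sigma(L)$ denotes the alphabet. Operators: action prefix $a.L$ ($a\neq\tau$): new initial state $\hat s'$, alphabet $\Sigma\cup\{a\}$, transitions $\Delta\cup\{(\hat s',a,\hat s)\}$. Hiding $L\setminus A$: alphabet $\Sigma\setminus A$, each transition labelled by an element of $A$ relabelled $\tau$, otherwise unchanged. Relational renaming $L\Phi$ ($\Phi$ a set of pairs, $\tau$ not in its domain $\mathcal D(\Phi)$ or range; $\Phi(a,b)$ means $(a,b)\in\Phi$ or $a=b\notin\mathcal D(\Phi)$): alphabet $\{b\mid\exists a\in\Sigma:\Phi(a,b)\}$, transitions $\{(s,b,s')\mid\exists a:(s,a,s')\in\Delta\wedge\Phi(a,b)\}$, same states and initial state. Parallel composition $L_1\|L_2$: states $S_1\times S_2$, alphabet $\Sigma_1\cup\Sigma_2$, initial $(\hat s_1,\hat s_2)$; actions in $\Sigma_1\cap\Sigma_2$ are taken jointly by both components, all other actions (including $\tau$) by one component while the other stays put.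 A congruence is an equivalence $\cong$ with $L\cong L'\Rightarrow a.L\cong a.L',\ L\setminus A\cong L'\setminus A,\ L\Phi\cong L'\Phi,\ L\|L''\cong L'\|L'',\ L''\|L\cong L''\|L'$. For $\sigma=a_1\cdots a_n\in\Sigma^*$, $s\stackrel{\sigma}{\Rightarrow}s'$ means a finite path from $s$ to $s'$ whose non-$\tau$ labels are exactly $a_1,\dots,a_n$ in order; $\hat s\stackrel{\xi}{\Rightarrow}$ for $\xi\in\Sigma^\omega$ means an infinite path from $\hat s$ whose non-$\tau$ label sequence is $\xi$; $s\stackrel{\tau^\omega}{\to}$ means an infinite path of $\tau$-transitions from $s$. Define $\mathit{Tr}(L)=\{\sigma\in\Sigma^*\mid\exists s:\hat s\stackrel\sigma\Rightarrow s\}$, $\mathit{Div}(L)=\{\sigma\in\Sigma^*\mid\exists s:\hat s\stackrel\sigma\Rightarrow s\wedge s\stackrel{\tau^\omega}\to\}$, $\mathit{Inf}(L)=\{\xi\in\Sigma^\omega\mid\hat s\stackrel\xi\Rightarrow\}$, $\mathit{Sf}(L)=\{(\sigma,A)\in\Sigma^*\times2^\Sigma\mid\exists s:\hat s\stackrel\sigma\Rightarrow s\wedge\forall a\in A\cup\{\tau\}\,\forall s':(s,a,s')\notin\Delta\}$, and $\mathit{aenI}(L)=\{a_1a_2\cdots\in\mathit{Inf}(L)\mid\forall n\ge0\,\exists i\ge n: a_1\cdots a_i\notin\mathit{Div}(L)\}$. $L\doteq L'$ (CFFD-equivalence) iff $\Sigma,\mathit{Sf},\mathit{Div},\mathit{Inf}$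 all agree on $L$ and $L'$. An equivalence preserves $X$ if $L\cong L'\Rightarrow X(L)=X(L')$; the equivalence induced by $\Sigma,X_1,\dots,X_k$ relates $L,L'$ iff all these functions agree on them. *)

(* Defs.v *)
From mathcomp Require Import all_boot.
From mathcomp Require Import boolp classical_sets functions cardinality.
From Corelib Require Export RelationClasses.

Set Implicit Arguments.
Unset Strict Implicit.
Unset Printing Implicit Defensive.

Local Open Scope classical_set_scope.

(* Visible actions live in a type [Act]; a transition label is an [option Act],
   where [None] is the invisible action tau and [Some a] is the visible [a]. *)
Record LTS (Act : Type) : Type := MkLTS {
  state : Type;
  alph : set Act;
  trans : state -> option Act -> state -> Prop;
  init : state;
  trans_alph : forall s a s', trans s (Some a) s' -> alph a
}.

Section Operators.
Variable Act : Type.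
Implicit Types (L : LTS Act) (a b : Act) (x : option Act) (A : set Act)
  (Phi : set (Act * Act)).

(* The state [None] is the new initial state. *)
Inductive prefix_trans a L :
    option (state L) -> option Act -> option (state L) -> Prop :=
| prefix_new : prefix_trans a None (Some a) (Some (init L))
| prefix_old s x s' : trans s x s' -> prefix_trans a (Some s) x (Some s').

Lemma prefix_trans_alph a L s b s' :
  @prefix_trans a L s (Some b) s' -> (a |` alph L) b.
Proof.
move E : (Some b) => x H; case: H E => [[->]|u y u' H E]; first by left.
by right; move: H; rewrite -E; apply: trans_alph.
Qed.

Definition prefix a L : LTS Act :=
  MkLTS None (@prefix_trans_alph a L).

Inductive hide_trans L A : state L -> option Act -> state L -> Prop :=
| hide_keep s x s' : ~ (Some @` A) x -> trans s x s' -> hide_trans A s x s'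
| hide_tau s a s' : A a -> trans s (Some a) s' -> hide_trans A s None s'.

Lemma hide_trans_alph L A s b s' :
  @hide_trans L A s (Some b) s' -> (alph L `\` A) b.
Proof.
move E : (Some b) => x H; case: H E => [u y u' nA H E|//].
subst y; split; first exact: trans_alph H.
by move=> Ab; apply: nA; exists b.
Qed.

Definition hide L A : LTS Act :=
  MkLTS (init L) (@hide_trans_alph L A).

(* Actions outside the domain are left unchanged. *)
Definition renames Phi a b : Prop :=
  Phi (a, b) \/ (a = b /\ ~ exists c, Phi (a, c)).

Inductive rename_trans L Phi : state L -> option Act -> state L -> Prop :=
| rename_tau s s' : trans s None s' -> rename_trans Phi s None s'
| rename_vis s a b s' : renames Phi a b -> trans s (Some a) s' ->
    rename_trans Phi s (Some b) s'.

Lemma rename_trans_alph L Phi s b s' :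
  @rename_trans L Phi s (Some b) s' ->
  [set c | exists2 a, alph L a & renames Phi a c] b.
Proof.
move E : (Some b) => x H; case: H E => [//|u a c u' r H [->]].
by exists a => //; exact: trans_alph H.
Qed.

Definition rename L Phi : LTS Act :=
  MkLTS (init L) (@rename_trans_alph L Phi).

Inductive par_trans L1 L2 :
    state L1 * state L2 -> option Act -> state L1 * state L2 -> Prop :=
| par_sync s1 s2 a t1 t2 : alph L1 a -> alph L2 a ->
    trans s1 (Some a) t1 -> trans s2 (Some a) t2 ->
    par_trans (s1, s2) (Some a) (t1, t2)
| par_left s1 s2 x t1 : ~ (Some @` alph L2) x -> trans s1 x t1 ->
    par_trans (s1, s2) x (t1, s2)
| par_right s1 s2 x t2 : ~ (Some @` alph L1) x -> trans s2 x t2 ->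
    par_trans (s1, s2) x (s1, t2).

Lemma par_trans_alph L1 L2 s b s' :
  @par_trans L1 L2 s (Some b) s' -> (alph L1 `|` alph L2) b.
Proof.
move E : (Some b) => x H; case: H E => [s1 s2 a t1 t2 a1 _ _ _ [->]|s1 s2 y t1 _ H E|
  s1 s2 y t2 _ H E]; first by left.
- by left; move: H; rewrite -E; apply: trans_alph.
- by right; move: H; rewrite -E; apply: trans_alph.
Qed.

Definition par L1 L2 : LTS Act :=
  MkLTS (init L1, init L2) (@par_trans_alph L1 L2).

End Operators.

Record congruence (Act : Type) (R : LTS Act -> LTS Act -> Prop) : Prop := {
  congruence_equiv : Equivalence R;
  congruence_prefix : forall a L L', R L L' -> R (prefix a L) (prefix a L');
  congruence_hide : forall A L L', R L L' -> R (hide L A) (hide L' A);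
  congruence_rename : forall Phi L L',
    R L L' -> R (rename L Phi) (rename L' Phi);
  congruence_parl : forall L'' L L', R L L' -> R (par L L'') (par L' L'');
  congruence_parr : forall L'' L L', R L L' -> R (par L'' L) (par L'' L')
}.

Section Semantics.
Variable Act : Type.
Implicit Types (L : LTS Act) (sigma : seq Act) (xi : nat -> Act).

Inductive weak_path L : state L -> seq Act -> state L -> Prop :=
| weak_nil s : weak_path s [::] s
| weak_tau s s' sigma t : trans s None s' -> weak_path s' sigma t ->
    weak_path s sigma t
| weak_vis s a s' sigma t : trans s (Some a) s' -> weak_path s' sigma t ->
    weak_path s (a :: sigma) t.

(* [k n] is the position of the [n]-th visible label of the infinite path;
   [k] enumerates all the visible positions in increasing order. *)
Definition weak_infinite_path L (s : state L) xi : Prop :=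
  exists (p : nat -> state L) (l : nat -> option Act) (k : nat -> nat),
    [/\ p 0 = s,
        forall i, trans (p i) (l i) (p i.+1),
        {homo k : m n / m < n},
        forall n, l (k n) = Some (xi n)
      & forall i, (forall n, i <> k n) -> l i = None].

Definition diverges L (s : state L) : Prop :=
  exists p : nat -> state L, p 0 = s /\ forall i, trans (p i) None (p i.+1).

Definition Div L : set (seq Act) :=
  [set sigma | exists s, weak_path (init L) sigma s /\ diverges s].

Definition Inf L : set (nat -> Act) :=
  [set xi | weak_infinite_path (init L) xi].

Definition Sf L : set (seq Act * set Act) :=
  [set f | f.2 `<=` alph L /\
    exists s : state L, weak_path (init L) f.1 s /\
      (forall s', ~ trans s None s') /\
      (forall a s', f.2 a -> ~ trans s (Some a) s')].

(* [mkseq xi i] is the prefix of [xi] of length [i]. *)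
Definition aenI L : set (nat -> Act) :=
  [set xi | Inf L xi /\ forall n, exists2 i, n <= i & ~ Div L (mkseq xi i)].

Definition CFFD_equiv L L' : Prop :=
  [/\ alph L = alph L', Sf L = Sf L', Div L = Div L' & Inf L = Inf L'].

End Semantics.

Definition preserves (Act T : Type) (R : LTS Act -> LTS Act -> Prop)
    (X : LTS Act -> T) : Prop :=
  forall L L', R L L' -> X L = X L'.

(* Main.v *)
(** Traces are determined by [Div] and [Sf], since every state either reaches a
    stable state invisibly or diverges; composing in parallel with
    [a.deadlock] then shows that the alphabet is preserved as well.

    Conversely, let [M1] and [M2] be related and [xi] in [Inf M1] but not in
    [Inf M2].  For every [L] there is a context such that the image of [M2] is
    CFFD-equivalent to [L], while the image of [M1] differs from it only in
    that [Inf] is enlarged by all sequences [x] almost all of whose prefixes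
    lie in [Div L].  The context runs [L]; after reaching a divergence trace
    it may leave [L], start the guest [M], and from then on permit any further
    divergence trace, provided the guest advances one step along [xi] between
    two consecutive visible actions.  Once started, the guest may idle on tau,
    which makes all these states divergent.  Hence [L] is related to the image
    of [M1], whose CFFD semantics only depends on [alph L], [Sf L], [Div L]
    and [aenI L]. *)
Require Import Defs.
From mathcomp Require Import all_boot.
From mathcomp Require Import boolp classical_sets functions cardinality.

Set Implicit Arguments.
Unset Strict Implicit.
Unset Printing Implicit Defensive.

Local Open Scope classical_set_scope.

(** * Finite weak paths, dependent choice and traces *)

Section WeakPaths.
Variables (Act : Type) (L : LTS Act).
Implicit Types (s t : state L) (sigma rho : seq Act) (xi : nat -> Act).

Lemma weak_path_cat s t u sigma rho :
  weak_path s sigma t -> weak_path t rho u -> weak_path s (sigma ++ rho) u.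
Proof.
elim=> [//|v v' ? ? H _ IH /IH|v a v' ? ? H _ IH /IH]; first exact: weak_tau H.
exact: weak_vis H.
Qed.

Lemma weak_path_tau1 s t : trans s None t -> weak_path s [::] t.
Proof. by move=> H; apply: (weak_tau H); exact: weak_nil. Qed.

Lemma weak_path_vis1 s a t : trans s (Some a) t -> weak_path s [:: a] t.
Proof. by move=> H; apply: (weak_vis H); exact: weak_nil. Qed.

Lemma weak_path_step s t a u :
  weak_path s [::] t -> trans t (Some a) u -> weak_path s [:: a] u.
Proof. by move=> st /weak_path_vis1; exact: (weak_path_cat st). Qed.

Lemma weak_path_cons_inv s a sigma t : weak_path s (a :: sigma) t ->
  exists u v, [/\ weak_path s [::] u, trans u (Some a) v & weak_path v sigma t].
Proof.
move E : (a :: sigma) => r H; elim: H E => [//|v v' ? ? H _ IH /IH|v b v' ? ? H W _].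
  by case=> u [w [su uw wt]]; exists u, w; split => //; apply: weak_tau su.
by case=> -> ->; exists v, v'; split => //; exact: weak_nil.
Qed.

Lemma weak_path_cat_inv s sigma rho t : weak_path s (sigma ++ rho) t ->
  exists2 u, weak_path s sigma u & weak_path u rho t.
Proof.
elim: sigma s => [|a sigma IH] s /=; first by exists s => //; exact: weak_nil.
move=> /weak_path_cons_inv[u [v [su uv /IH[w vw wt]]]]; exists w => //.
exact: (weak_path_cat (weak_path_step su uv)) vw.
Qed.

Lemma weak_path_rcons_inv s sigma a t : weak_path s (rcons sigma a) t ->
  exists u v, weak_path s sigma u /\ trans u (Some a) v.
Proof.
rewrite -cats1 => /weak_path_cat_inv[w sw].
case/weak_path_cons_inv=> u [v [wu uv _]]; exists u, v; split=> //.
by rewrite -[sigma]cats0; exact: weak_path_cat wu.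
Qed.

Lemma weak_path_invariant (I : seq Act -> state L -> Prop) :
  (forall rho s t, I rho s -> trans s None t -> I rho t) ->
  (forall rho s a t, I rho s -> trans s (Some a) t -> I (rcons rho a) t) ->
  forall rho s sigma t, I rho s -> weak_path s sigma t -> I (rho ++ sigma) t.
Proof.
move=> Itau Ivis rho s sigma t + st; elim: st rho => [u rho|u v|u a v]; first by rewrite cats0.
  by move=> ? w uv _ IH rho Iu; apply: IH; exact: Itau uv.
by move=> ? w uv _ IH rho Iu; rewrite -cat_rcons; apply: IH; exact: Ivis uv.
Qed.

Lemma div_alph sigma a : Div L (rcons sigma a) -> alph L a.
Proof.
by move=> [s [/weak_path_rcons_inv[u [v [_ uv]]] _]]; exact: trans_alph uv.
Qed.

(** Dependent choice, obtained by iterating a choice function on the subtype cut out by [P]. *)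
Lemma iter_choice (T : Type) (P : T -> Prop) (S : T -> T -> Prop) :
  (forall x, P x -> exists2 y, S x y & P y) -> forall x, P x ->
  exists f : nat -> T, [/\ f 0 = x, forall n, S (f n) (f n.+1) & forall n, P (f n)].
Proof.
move=> step x Px.
have : forall z : {z | P z}, exists y : {z | P z}, S (sval z) (sval y).
  by move=> [z Pz]; have [y zy Py] := step z Pz; exists (exist _ y Py).
move=> /choice[f fP]; exists (fun n => sval (iter n f (exist _ x Px))); split=> //.
by move=> n; case: (iter n f _).
Qed.

(** If no stable state can be reached invisibly, every state so reached has a tau-successor, and
    dependent choice strings these together. *)
Lemma stable_or_diverges s : diverges s \/
  exists2 t, weak_path s [::] t & forall u, ~ trans t None u.
Proof.
have [|nst] := pselect (exists2 t, weak_path s [::] t & forall u, ~ trans t None u).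
  by right.
left; have [|f [f0 fS _]] :=
  @iter_choice _ (weak_path s [::]) (fun u v => trans u None v) _ s (weak_nil s).
  move=> u su; apply: contrapT => nu; apply: nst; exists u => // v uv.
  by apply: nu; exists v => //; exact: weak_path_cat su (weak_path_tau1 uv).
by exists f.
Qed.

(** With the empty refusal set, [Sf] only asks that [sigma] can lead to a stable state. *)
Lemma traceE sigma : (exists s, weak_path (init L) sigma s) <->
  Div L sigma \/ Sf L (sigma, set0).
Proof.
split=> [[s Ls]|[[s [Ls _]]|[_ [s [Ls _]]]]]; try by exists s.
have [sd|[t st nt]] := stable_or_diverges s; first by left; exists s.
right; split=> [? []|]; exists t; split; last by split=> // ? ? [].
by rewrite -[sigma]cats0; exact: weak_path_cat st.
Qed.

End WeakPaths.

(** * Infinite weak paths as sequences of single visible steps *)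

Section InfinitePaths.
Variables (Act : Type) (L : LTS Act).
Implicit Types (s t : state L) (xi : nat -> Act).

Lemma weak_infinite_path_steps s xi : weak_infinite_path s xi ->
  exists2 q : nat -> state L, q 0 = s & forall n,
    exists2 t, weak_path (q n) [::] t & trans t (Some (xi n)) (q n.+1).
Proof.
case=> p [l [k [p0 pS kS lk lN]]].
have kle m n : m <= n -> k m <= k n.
  by rewrite leq_eqVlt => /predU1P[->//|/kS/ltnW].
have tau i j : i <= j -> (forall h, i <= h < j -> forall n, h <> k n) ->
    weak_path (p i) [::] (p j).
  elim: j => [|j IH]; first by rewrite leqn0 => /eqP->; constructor.
  rewrite leq_eqVlt => /predU1P[->|]; first by constructor.
  rewrite ltnS => ij H; rewrite -[[::]]cats0; apply: (@weak_path_cat _ _ _ (p j)).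
    by apply: IH => // h /andP[ih hj]; apply: H; rewrite ih ltnW.
  have lj : l j = None by apply: lN; apply: H; rewrite ij /=.
  by apply: weak_path_tau1; rewrite -lj.
(* After [m.+1] visible actions the path is at the target of the transition at position [k m], hence
   the successor. *)
exists (fun n => if n is m.+1 then p (k m).+1 else p 0) => // n.
exists (p (k n)); last by rewrite -lk.
case: n => [|n]; apply: tau => //.
- by move=> h /andP[_ h0] m hE; move: h0; rewrite hE ltnNge kle.
- exact: kS.
- move=> h /andP[nh hn] m hE; subst h.
  have [mn|nm] := leqP m n; first by move: nh; rewrite ltnNge kle.
  by move: hn; rewrite ltnNge kle.
Qed.

Fixpoint tau_steps (m : nat) s t : Prop :=
  if m is m'.+1 then exists2 u, trans s None u & tau_steps m' u t else s = t.

Lemma weak_path_tau_steps s t : weak_path s [::] t -> exists m, tau_steps m s t.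
Proof.
move E : [::] => r H; elim: H E => [u _|u v ? w uv _ IH /IH[m vw]|//].
  by exists 0.
by exists m.+1, v.
Qed.

(* A chosen path also records the number of tau-transitions remaining before
   the next visible action, which ensures that this action is reached. *)
Lemma weak_infinite_pathI (G : nat -> state L -> Prop) xi :
  (forall n s, G n s -> exists2 t, weak_path s [:: xi n] t & G n.+1 t) ->
  forall n0 s s0, weak_path s (mkseq xi n0) s0 -> G n0 s0 ->
  weak_infinite_path s xi.
Proof.
move=> step n0 s s0 ss0 G0.
(* [G] need not hold at the start: from [u] it suffices to perform [xi] from index [n] up to some
   index [m] where [G] is met. *)
pose H n u := exists m v, n <= m /\ weak_path u (map xi (iota n (m - n))) v /\ G m v.
have Hstep n u : H n u -> exists w v,
    [/\ weak_path u [::] w, trans w (Some (xi n)) v & H n.+1 v].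
  case=> m [v [nm [uv Gv]]].
  have [m' [v' [nm' [uv' Gv']]]] : exists m' v', n < m' /\
      weak_path u (map xi (iota n (m' - n))) v' /\ G m' v'.
    (* If [G] is met at index [n] itself, one application of [step] moves the meeting point to
       [n.+1]. *)
    case: (ltngtP n m) nm => // [nm _|nm _]; first by exists m, v.
    have [t vt Gt] := step _ _ Gv; exists m.+1, t; split; first by rewrite nm.
    split=> //; move: uv; rewrite -nm subnn subSnn /= => uv.
    by rewrite nm -[[:: _]]cat0s; exact: weak_path_cat vt.
  have E : m' - n = (m' - n.+1).+1 by rewrite subnSK.
  rewrite E /= in uv'. have [w [t [uw wt tv]]] := weak_path_cons_inv uv'.
  by exists w, t; split=> //; exists m', v'; split.
(* A triple holds the current state, the number of tau-steps left and the index of the next visible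
   action. *)
pose V (z : state L * nat * nat) := exists2 w, tau_steps z.1.2 z.1.1 w &
  exists2 v, trans w (Some (xi z.2)) v & H z.2.+1 v.
have HV n u : H n u -> exists m, V (u, m, n).
  case/Hstep=> w [v [/weak_path_tau_steps[m uw] wv Hv]].
  by exists m, w => //; exists v.
pose S (z z' : state L * nat * nat) :=
  trans z.1.1 (if z.1.2 == 0 then Some (xi z.2) else None) z'.1.1 /\
  (if z.1.2 is m.+1 then z'.1.2 = m /\ z'.2 = z.2 else z'.2 = z.2.+1).
have VS z : V z -> exists2 z', S z z' & V z'.
  case: z => [[u [|m]] n] [w /= uw [v wv Hv]].
    rewrite -uw in wv; have [m Vm] := HV _ _ Hv.
    by exists (v, m, n.+1).
  by case: uw => u' uu' u'w; exists (u', m, n) => //; exists w => //; exists v.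
have [m0 V0] : exists m, V (s, m, 0).
  by apply: HV; exists n0, s0; rewrite subn0.
have [f [f0 fS _]] := iter_choice VS V0.
have mono1 i : (f i).2 <= (f i.+1).2.
  by case: (fS i) => _; case: ((f i).1.2) => [->|m [_ ->]].
have mono i j : i <= j -> (f i).2 <= (f j).2.
  elim: j => [|j IH]; first by rewrite leqn0 => /eqP->.
  rewrite leq_eqVlt => /predU1P[->//|]; rewrite ltnS => /IH /leq_trans; exact.
have jump i : (f i).1.2 = 0 -> (f i.+1).2 = (f i).2.+1.
  by move=> E; case: (fS i); rewrite E.
(* The countdown reaches zero before the index changes, so no index is skipped. *)
have zero m : forall i, (f i).1.2 = m ->
    exists2 j, (f j).1.2 = 0 & (f j).2 = (f i).2.
  elim: m => [|m IH] i E; first by exists i.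
  case: (fS i) => _; rewrite E => -[/IH[j j0 jE] iE].
  by exists j => //; rewrite jE.
have : forall n, exists j, (f j).1.2 = 0 /\ (f j).2 = n.
  elim=> [|n [j [j0 jn]]].
    by have [j j0 jE] := zero _ 0 erefl; exists j; rewrite jE f0.
  have [i i0 iE] := zero _ j.+1 erefl.
  by exists i; rewrite iE jump // jn.
case/choice=> k kP.
exists (fun i => (f i).1.1), (fun i => if (f i).1.2 == 0 then Some (xi (f i).2) else None), k.
split.
- by rewrite f0.
- by move=> i; case: (fS i).
- move=> m n mn; rewrite ltnNge; apply/negP => /mono.
  by have [_ ->] := kP n; have [_ ->] := kP m; rewrite leqNgt mn.
- by move=> n; have [-> ->] := kP n.
(* The index strictly grows after a position with countdown zero, so such a position is determined
   by its index and is one of the [k n]. *)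
- move=> i iN; case: eqP => // i0; case: (iN (f i).2).
  have [j0 jn] := kP (f i).2; move: j0 jn; move: (k _) => j j0 jn.
  case: (ltngtP i j) => // ij.
    by have := mono _ _ ij; rewrite (jump _ i0) jn ltnn.
  by have := mono _ _ ij; rewrite (jump _ j0) jn ltnn.
Qed.

End InfinitePaths.

(** * Preservation of the alphabet *)

Section PreservesAlphabet.
Variables (Act : Type) (R : LTS Act -> LTS Act -> Prop).
Hypotheses (Rcong : congruence R) (RSf : preserves R (@Sf Act))
  (RDiv : preserves R (@Div Act)).

Definition deadlock : LTS Act :=
  @MkLTS Act unit set0 (fun _ _ _ => False) tt (fun _ _ _ => False_ind _).

Lemma trace_preserved L L' sigma : R L L' ->
  (exists s, weak_path (init L) sigma s) -> exists s, weak_path (init L') sigma s.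
Proof. by move=> RL; rewrite !traceE (RSf RL) (RDiv RL). Qed.

(* If [a] is in the alphabet of [L'] only, then [a.deadlock] performs [a]
   alone next to [L], but needs the cooperation of [L'] next to [L']; so [a]
   is a trace of [L'], hence of [L]. *)
Lemma alph_sub L L' : R L L' -> alph L' `<=` alph L.
Proof.
move=> RL a L'a; apply: contrapT => La.
have RN := congruence_parl Rcong (Defs.prefix a deadlock) RL.
have [|d Hd] := @trace_preserved _ _ [:: a] RN.
  exists (init L, Some tt); apply: weak_path_vis1; apply: par_right; last by constructor.
  by case=> b Lb [ba]; apply: La; rewrite -ba.
have [d1 [d2 [dd1 d12 _]]] := weak_path_cons_inv Hd.
have step (e e' : state (par L' (Defs.prefix a deadlock))) :
    trans e None e' -> weak_path e.1 [::] e'.1.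
  move E : None => x st; case: st E =>
    [s1 s2 b t1 t2 _ _ _ _|s1 s2 y t1 _ H|s1 s2 y t1 _ _] E //=.
  - by apply: weak_path_tau1; rewrite E.
  - by constructor.
have tau : weak_path (init L') [::] d1.1.
  pose I (rho : seq Act) (e : state (par L' (Defs.prefix a deadlock))) :=
    rho = [::] -> weak_path (init L') [::] e.1.
  apply: (@weak_path_invariant _ _ I _ _ [::] _ [::] _ _ dd1) => //.
  - move=> rho e e' Ie ee' r0; rewrite -[[::]]cat0s.
    exact: weak_path_cat (Ie r0) (step _ _ ee').
  - by move=> [].
  - by move=> _; exact: weak_nil.
(* Both alphabets contain [a], so only [par_sync] can produce this step. *)
have vis : exists t, trans d1.1 (Some a) t.
  move: d12; move E : (Some a) => x st; case: st E =>
    [s1 s2 b t1 t2 _ _ H _|s1 s2 y t1 H _|s1 s2 y t1 H _] E /=.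
  - by exists t1.
  - by case: H; exists a; first left.
  - by case: H; exists a.
have RL' : R L' L by have [_ sR _] := congruence_equiv Rcong; exact: sR.
have [t d1t] := vis.
have [|u] := @trace_preserved _ _ [:: a] RL'.
  by exists t; exact: weak_path_step tau d1t.
by move=> wu; have [? [? [_ av _]]] := weak_path_cons_inv wu; exact: La (trans_alph av).
Qed.

Lemma alph_preserved : preserves R (@alph Act).
Proof.
move=> L L' RL; apply/seteqP; split; last exact: alph_sub.
by have [_ sR _] := congruence_equiv Rcong; exact: alph_sub (sR _ _ RL).
Qed.

End PreservesAlphabet.

(** * The context and an explicit form of its transitions *)

Section Context.
Variables (Act : Type) (phi : Act -> Act) (c : Act) (xi : nat -> Act).
Hypotheses (phi_inj : injective phi) (phi_c : forall a, phi a <> c).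

Inductive driver_trans : nat -> option Act -> nat -> Prop :=
| driver_idle n : driver_trans n None n
| driver_step n : driver_trans n (Some (xi n)) n.+1.

(** The alphabet [setT] makes the driver join every visible action of the guest, which can therefore
    only follow [xi]. *)
Definition driver : LTS Act :=
  @MkLTS Act nat setT driver_trans 0 (fun _ _ _ _ => I).

(* The second component is the trace executed so far; the first is a state of
   [L], or, after leaving [L], whether the guest has made its step since the
   last visible action.  Renaming by [phi] keeps [c] fresh. *)
Inductive host_trans (L : LTS Act) :
  (state L + bool) * seq Act -> option Act -> (state L + bool) * seq Act -> Prop :=
| host_tau s t sigma : trans s None t ->
    host_trans (inl s, sigma) None (inl t, sigma)
| host_vis s a t sigma : trans s (Some a) t ->
    host_trans (inl s, sigma) (Some (phi a)) (inl t, rcons sigma a)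
| host_leave s a t sigma : trans s (Some a) t -> Div L (rcons sigma a) ->
    host_trans (inl s, sigma) (Some (phi a)) (inr false, rcons sigma a)
| host_tick sigma : host_trans (inr false, sigma) (Some c) (inr true, sigma)
| host_div a sigma : Div L (rcons sigma a) ->
    host_trans (inr true, sigma) (Some (phi a)) (inr false, rcons sigma a).

Lemma host_trans_alph L s a t : @host_trans L s (Some a) t ->
  (c |` phi @` alph L) a.
Proof.
move E : (Some a) => x st; case: st E => //.
- by move=> u b v _ uv [->]; right; exists b => //; exact: trans_alph uv.
- by move=> u b v _ uv _ [->]; right; exists b => //; exact: trans_alph uv.
- by move=> _ [->]; left.
- by move=> b sigma Db [->]; right; exists b => //; exact: div_alph Db.
Qed.

Definition host L : LTS Act := MkLTS (inl (init L), [::]) (@host_trans_alph L).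

(** The prefix keeps the guest and the idle loop from running before the first tick of the host, so
    that stable states of [L] stay stable. The renaming turns every visible action into a tick
    [c]. *)
Definition ticker M : LTS Act :=
  Defs.prefix c (rename (par M driver) [set p | p.2 = c]).

(** Hiding makes the ticks invisible; the outer renaming inverts [phi]. *)
Definition context L M : LTS Act :=
  rename (Defs.hide (par (ticker M) (host L)) [set c]) [set p | p.1 = phi p.2].

(** The transitions of [context] in explicit form: [None] is a guest not yet started, [Some (m, j)]
    a guest in state [m] after [j] actions of [xi]. *)
Inductive ctx_trans (L M : LTS Act) :
  option (state M * nat) * ((state L + bool) * seq Act) -> option Act ->
  option (state M * nat) * ((state L + bool) * seq Act) -> Prop :=
| ctx_tau k s t sigma : trans s None t ->
    ctx_trans (k, (inl s, sigma)) None (k, (inl t, sigma))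
| ctx_vis k s a t sigma : trans s (Some a) t ->
    ctx_trans (k, (inl s, sigma)) (Some a) (k, (inl t, rcons sigma a))
| ctx_leave k s a t sigma : trans s (Some a) t -> Div L (rcons sigma a) ->
    ctx_trans (k, (inl s, sigma)) (Some a) (k, (inr false, rcons sigma a))
| ctx_start sigma : ctx_trans (None, (inr false, sigma)) None
    (Some (init M, 0), (inr true, sigma))
| ctx_tick m j m' sigma : trans m (Some (xi j)) m' ->
    ctx_trans (Some (m, j), (inr false, sigma)) None
      (Some (m', j.+1), (inr true, sigma))
| ctx_div k a sigma : Div L (rcons sigma a) ->
    ctx_trans (k, (inr true, sigma)) (Some a) (k, (inr false, rcons sigma a))
| ctx_guest m j m' h : trans m None m' ->
    ctx_trans (Some (m, j), h) None (Some (m', j), h)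
| ctx_idle m j h : ctx_trans (Some (m, j), h) None (Some (m, j), h).

Lemma ctx_trans_alph L M s a t : @ctx_trans L M s (Some a) t -> alph L a.
Proof.
move E : (Some a) => x st; case: st E => //.
- by move=> k u b v sigma uv [->]; exact: trans_alph uv.
- by move=> k u b v sigma _ Db [->]; exact: div_alph Db.
- by move=> k b sigma Db [->]; exact: div_alph Db.
Qed.

Definition ctx L M : LTS Act :=
  MkLTS (None, (inl (init L), [::])) (@ctx_trans_alph L M).

Lemma LTS_eq (S : Type) (A A' : set Act) (T T' : S -> option Act -> S -> Prop) i
    (TA : forall s a t, T s (Some a) t -> A a)
    (TA' : forall s a t, T' s (Some a) t -> A' a) :
  A = A' -> (forall s x t, T s x t <-> T' s x t) -> MkLTS i TA = MkLTS i TA'.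
Proof.
move=> AA' TT'; have TE : T = T'.
  by apply/funext => s; apply/funext => x; apply/funext => t; exact/propext.
by subst; congr (MkLTS i _); exact: Prop_irrelevance.
Qed.

(** By [Mxi] each [xi n] requires the guest; otherwise the driver could perform it alone. *)
Lemma ticker_transE M (Mxi : forall n, alph M (xi n)) k x k' :
  trans (l := ticker M) k x k' <->
  match k, x, k' with
  | None, Some a, Some (m, n) => [/\ a = c, m = init M & n = 0]
  | Some (m, n), None, Some (m', n') =>
      n = n' /\ (trans m None m' \/ m = m')
  | Some (m, n), Some a, Some (m', n') =>
      [/\ a = c, n' = n.+1 & trans m (Some (xi n)) m']
  | _, _, _ => False
  end.
Proof.
split.
- case=> [//|[m n] y [m' n'] st].
  inversion st as [u v uv|u a b v ab uv]; subst.
  + inversion uv as [| ? ? ? ? _ mm'|? ? ? ? _ nn']; subst; first by split=> //; left.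
    by inversion nn'; subst; split=> //; right.
  + have -> : b = c by case: ab => [//|[_ []]]; exists c.
    inversion uv as [? ? ? ? ? Ma _ mm' nn'|? ? ? ? na|? ? ? ? na nn']; subst.
    * by inversion nn'; subst.
    * by case: na; exists a.
    * by inversion nn'; subst; case: na; exists (xi n).
- case: k x k' => [[m n]|] [a|] [[m' n']|] //=.
  + case=> -> -> mm'; apply: prefix_old; apply: (@rename_vis _ _ _ _ (xi n)); first by left.
    by apply: par_sync => //; constructor.
  + case=> <- [mm'|<-]; apply: prefix_old; apply: rename_tau.
      by apply: par_left mm' => -[].
    by apply: par_right; [move=> -[] | constructor].
  + by case=> -> -> ->; exact: prefix_new.
Qed.

Lemma ticker_alphE M : alph (ticker M) = [set c].
Proof.
apply/seteqP; split=> [a [->//|/= [b _ [//|[_ []]]]]|a ->]; last by left.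
by exists c.
Qed.

Lemma host_alphE L : alph (host L) = c |` phi @` alph L. Proof. by []. Qed.

(** The two alphabets share exactly [c], which [phi] avoids: ticks are joint, and every other step
    belongs to one side. *)
Lemma hosted_transE L M k h x k' h' :
  trans (l := par (ticker M) (host L)) (k, h) x (k', h') <->
  [\/ [/\ x = None, trans (l := ticker M) k None k' & h = h'],
     [/\ x = None, k = k' & trans (l := host L) h None h'],
     [/\ x = Some c, trans (l := ticker M) k (Some c) k' &
                    trans (l := host L) h (Some c) h'] |
     exists a, [/\ x = Some (phi a), k = k' & trans (l := host L) h x h']].
Proof.
split=> [st|].
  inversion st as [? ? a ? ? ta _ kk' hh'|? ? ? ? nh kk'|? ? ? ? nk hh']; subst.
  - by rewrite ticker_alphE in ta; rewrite ta in kk' hh' *; apply: Or43.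
  - case: x kk' nh {st} => [a|] kk' nh; last by apply: Or41.
    have := trans_alph kk'; rewrite ticker_alphE => /= ac.
    by case: nh; exists a => //; left.
  - case: x hh' nk {st} => [a|] hh' nk; last by apply: Or42.
    have := trans_alph hh'; rewrite host_alphE => -[/= ac|[b Lb ba]].
      by case: nk; exists a; rewrite ?ticker_alphE.
    by apply: Or44; exists b; rewrite ba.
case=> [[-> kk' <-]|[-> <- hh']|[-> kk' hh']|[a [-> <- hh']]].
- by apply: par_left kk' => -[].
- by apply: par_right hh' => -[].
- by apply: par_sync => //; [exact: trans_alph kk' | exact: trans_alph hh'].
- apply: par_right hh' => -[b]; rewrite ticker_alphE => /= -> [ca].
  by case: (@phi_c a).
Qed.

Lemma context_transE L M (k k' : state (ticker M)) (h h' : state (host L)) x :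
  trans (l := context L M) (k, h) x (k', h') <->
  match x with
  | None => [\/ trans (l := ticker M) k None k' /\ h = h',
      k = k' /\ trans (l := host L) h None h' |
      trans (l := ticker M) k (Some c) k' /\ trans (l := host L) h (Some c) h']
  | Some a => k = k' /\ trans (l := host L) h (Some (phi a)) h'
  end.
Proof.
split=> [st|].
  inversion st as [? ? uv|? a b ? ab uv]; subst.
    inversion uv as [? ? ? nc pt|? a ? ca pt]; subst; move: pt => /hosted_transE.
      by case=> [[_ ? ?]|[_ ? ?]|[//]|[? [//]]]; [apply: Or31|apply: Or32].
    by case=> [[//]|[//]|[_ ? ?]|[b [[ab] _ _]]]; [apply: Or33|case: (@phi_c b); rewrite -ab].
  inversion uv as [? ? ? nc pt|]; subst; move: pt => /hosted_transE.
  case=> [[//]|[//]|[[ac] _ _]|[d [[ad] kk' hh']]].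
    by case: nc; exists a.
  case: ab => [/= ab|[ab []]]; first by rewrite -ab.
  by exists d; rewrite /= ad.
case: x => [a [<- hh']|].
  apply: (@rename_vis _ _ _ _ (phi a)); first by left.
  apply: hide_keep; first by case=> _ /= -> [ca]; case: (@phi_c a).
  by apply/hosted_transE; apply: Or44; exists a.
case=> [[kk' <-]|[<- hh']|[kk' hh']]; apply: rename_tau.
- apply: hide_keep; first by case.
  by apply/hosted_transE; apply: Or41.
- apply: hide_keep; first by case.
  by apply/hosted_transE; apply: Or42.
- by apply: (@hide_tau _ _ _ _ c) => //; apply/hosted_transE; apply: Or43.
Qed.

Lemma context_alphE L M : alph (context L M) = alph L.
Proof.
apply/seteqP; split=> [a [d [Ld dc] da]|a La].
  have {Ld} [b Lb bd] : (phi @` alph L) d.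
    by case: Ld => [|[//|//]]; rewrite ticker_alphE.
  case: da => [/= da|[_ []]]; first by rewrite -(phi_inj (etrans bd da)).
  by exists b.
exists (phi a); last by left.
by split=> [|/phi_c//]; right; right; exists a.
Qed.

(** Having an equality of systems, not just an equivalence, allows rewriting under [R]. *)
Lemma contextE L M (Mxi : forall n, alph M (xi n)) : context L M = ctx L M.
Proof.
apply: LTS_eq.
  exact: context_alphE.
move=> [k h] x [k' h'].
apply: (iff_trans (@context_transE L M k k' h h' x)).
split=> [|st].
- case: x => [a [<-]|[[/(ticker_transE Mxi) kk' <-]|[<-]|[/(ticker_transE Mxi) + hh']]].
  + move E : (Some (phi a)) => x hh'; case: hh' E => //.
    * by move=> s b t sigma st [/phi_inj->]; exact: ctx_vis.
    * by move=> s b t sigma st Db [/phi_inj->]; exact: ctx_leave st Db.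
    * by move=> sigma [/phi_c].
    * by move=> b sigma Db [/phi_inj->]; exact: ctx_div.
  + case: k k' kk' => [[m n]|] [[m' n']|] //=.
    by case=> <- [mm'|<-]; [exact: ctx_guest | exact: ctx_idle].
  + move E : None => x hh'; case: hh' E => // s t sigma st _.
    exact: ctx_tau.
  + move: hh'; move E : (Some c) => x hh'; case: hh' E => //.
    * by move=> s b t sigma st [cb]; case: (phi_c (esym cb)).
    * by move=> s b t sigma st Db [cb]; case: (phi_c (esym cb)).
    * move=> sigma _; case: k k' => [[m n]|] [[m' n']|] //=.
        by case=> _ -> mm'; exact: ctx_tick.
      by case=> _ -> ->; exact: ctx_start.
    * by move=> b sigma Db [cb]; case: (phi_c (esym cb)).
- inversion st; subst.
  + by apply: Or32; split=> //; constructor.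
  + by split=> //; constructor.
  + by split=> //; apply: host_leave; eassumption.
  + by apply: Or33; split; [apply/(ticker_transE Mxi) | constructor].
  + by apply: Or33; split; [apply/(ticker_transE Mxi) | constructor].
  + by split=> //; constructor.
  + by apply: Or31; split=> //; apply/(ticker_transE Mxi); split=> //; left.
  + by apply: Or31; split=> //; apply/(ticker_transE Mxi); split=> //; right.
Qed.
End Context.

(** * Divergences, stable failures and infinite traces of the context *)

Section ContextSemantics.
Variables (Act : Type) (xi : nat -> Act) (L M : LTS Act).
Implicit Types (x : nat -> Act) (sigma rho : seq Act).
Local Notation C := (ctx xi L M).

(** The clause for [inr] shows that leaving [L] adds no divergence trace; the last clause recovers a
    path of [M] from the guest. *)
Definition ctx_inv rho (d : state C) : Prop :=
  [/\ d.2.2 = rho,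
      match d.2.1 with
      | inl s => d.1 = None /\ weak_path (init L) rho s
      | inr ph => Div L rho /\ (ph -> d.1 <> None)
      end
    & forall m j, d.1 = Some (m, j) -> weak_path (init M) (mkseq xi j) m].

Lemma ctx_inv_path rho d : weak_path (init C) rho d -> ctx_inv rho d.
Proof.
apply: (@weak_path_invariant _ C ctx_inv _ _ [::]); last first.
- by split=> //; split=> //; exact: weak_nil.
- move=> {}rho [k [h sigma]] a d' [/= -> hI kI] st.
  inversion st as [|? s ? t ? sa|? s ? t ? sa Da| | |? ? ? Da| |]; subst; split=> //=.
  + case: hI => -> rs; split=> //; rewrite -cats1.
    exact: weak_path_cat rs (weak_path_vis1 sa).
- move=> {}rho [k [h sigma]] d' [/= -> hI kI] st.
  inversion st as [? s t ? sa| | |?|? ? ? ? mm'| |? ? ? ? mm'|]; subst; split=> //=.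
  + case: hI => -> rs; split=> //; rewrite -[rho]cats0.
    exact: weak_path_cat rs (weak_path_tau1 sa).
  + by case: hI.
  + by move=> ? ? [<- <-]; exact: weak_nil.
  + by case: hI.
  + move=> ? ? [<- <-]; rewrite mkseqS -cats1.
    by apply: weak_path_cat (weak_path_vis1 mm'); exact: kI.
  + by case: h hI {st} => [?|?] [].
  + move=> ? ? [<- <-]; rewrite -[mkseq _ _]cats0.
    by apply: weak_path_cat (weak_path_tau1 mm'); exact: kI.
Qed.

Lemma ctx_lift s sigma rho t : weak_path s rho t ->
  weak_path (L := C) (None, (inl s, sigma)) rho (None, (inl t, sigma ++ rho)).
Proof.
move=> st; elim: st sigma => [u|u v ? w uv _ IH|u a v ? w uv _ IH] sigma.
- by rewrite cats0; exact: weak_nil.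
- by apply: (@weak_tau _ C _ (None, (inl v, sigma))) => //; constructor.
- rewrite -cat_rcons.
  by apply: (@weak_vis _ C _ _ (None, (inl v, rcons sigma a))) => //; constructor.
Qed.

(** Neither leaving [L] nor starting the guest can be undone, so a path that ends inside [L] without
    a guest was there throughout. *)
Lemma ctx_proj (d d' : state C) rho s' : weak_path d rho d' ->
  d'.1 = None -> d'.2.1 = inl s' ->
  d.1 = None /\ exists2 s, d.2.1 = inl s & weak_path s rho s'.
Proof.
move=> dd' k' h'; elim: dd' k' h' => [u k' h'|u v ? w uv _ IH k' h'|u a v ? w uv _ IH k' h'].
- by split=> //; exists s' => //; exact: weak_nil.
- have [vN [t vt ts']] := IH k' h'.
  inversion uv as [? ? ? ? ut| | | | | | |]; subst => //=; move: vt => /= [<-] in ts' *.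
  by split=> //; eexists; first by []; apply: weak_tau ut ts'.
- have [vN [t vt ts']] := IH k' h'.
  inversion uv as [|? ? ? ? ? ut| | | | | |]; subst => //=; move: vt => /= [<-] in ts' *.
  by split=> //; eexists; first by []; apply: weak_vis ut ts'.
Qed.

(** Inside [L] the invisible steps are those of [L]; after leaving, the invariant says that the
    trace already belongs to [Div L]. *)
Lemma ctx_Div : Div C = Div L.
Proof.
apply/seteqP; split=> sigma.
  move=> [d [/ctx_inv_path[_ + _] [p [p0 pS]]]].
  case: d p0 => [k [[s|ph] rho]] p0 [] //= kN Ls; subst k.
  exists s; split=> //.
  have pE i : (p i).1 = None /\ exists t, (p i).2.1 = inl t.
    elim: i => [|i [pN [t pt]]]; first by rewrite p0; split=> //; exists s.
    move: (pS i) pN pt; move: (p i) (p i.+1) => d d' st.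
    by inversion st; subst => //= kN _; split=> //; eexists.
  exists (fun i => if (p i).2.1 is inl t then t else init L); split; first by rewrite p0.
  move=> i; have [+ [t]] := pE i.
  move: (pS i); move: (p i) (p i.+1) => d d' st.
  by inversion st; subst => //=.
case=> s [Ls [p [p0 pS]]]; exists (None, (inl s, sigma)); split.
  exact: (ctx_lift [::] Ls).
exists (fun i => (None, (inl (p i), sigma))); split; first by rewrite p0.
by move=> i; constructor.
Qed.

(** No reachable state outside [L] is stable: a started guest can idle, and an unstarted one can
    start. Inside [L], leaving only duplicates an action that [L] offers anyway, so refusals do not
    change. *)
Lemma ctx_Sf : Sf C = Sf L.
Proof.
apply/seteqP; split=> -[sigma A] [/= AL [d [Cd [dtau dA]]]]; split=> //=.
  have [dE + _] := ctx_inv_path Cd.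
  case: d Cd dtau dA dE => [[[m j]|] [[s|[|]] rho]] //= Cd dtau dA dE.
  - by case.
  - by case: (dtau _ (ctx_idle xi _ _ _)).
  - by case: (dtau _ (ctx_idle xi _ _ _)).
  - case=> _ Ls; exists s; split=> //; split.
      by move=> t st; apply: (dtau (None, (inl t, rho))); constructor.
    move=> a t Aa st; apply: (dA a (None, (inl t, rcons rho a)) Aa).
    by constructor.
  - by case=> _ [].
  - by case: (dtau _ (ctx_start xi _ _ _)).
exists (None, (inl d, sigma)); split; first exact: (ctx_lift [::] Cd).
split=> [d' st|a d' Aa st];
  inversion st as [? ? ? ? u|? ? ? ? ? u|? ? ? ? ? u| | | | |]; subst.
- exact: dtau u.
- exact: dA u.
- exact: dA u.
Qed.

Definition ev_div : set (nat -> Act) :=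
  [set x | exists n, forall i, n <= i -> Div L (mkseq x i)].

Lemma ctx_InfI : Inf L `<=` Inf C.
Proof.
move=> x /weak_infinite_path_steps[q q0 qS].
apply: (@weak_infinite_pathI _ C (fun n d => d = (None, (inl (q n), mkseq x n)))
  _ _ 0 _ (init C)); last by rewrite /= q0.
- move=> n _ ->; have [t qt tq] := qS n; eexists; last by [].
  by rewrite mkseqS -cats1; apply: ctx_lift; exact: weak_path_step qt tq.
- exact: weak_nil.
Qed.

Lemma ctx_tick_path m j sigma rho m' : weak_path m rho m' ->
  rho = [:: xi j] ->
  weak_path (L := C) (Some (m, j), (inr false, sigma)) [::]
    (Some (m', j.+1), (inr true, sigma)).
Proof.
move=> + rE; rewrite rE => mm'; have [u [v [mu uv vm']]] := weak_path_cons_inv mm'.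
have guest (n n' : state M) i h : weak_path n [::] n' ->
    weak_path (L := C) (Some (n, i), h) [::] (Some (n', i), h).
  move E : [::] => r nn'; elim: nn' E => [w _|w w' r' ? ww' _ IH E|//].
    exact: weak_nil.
  by apply: (@weak_tau _ C _ (Some (w', i), h)); [constructor | exact: IH].
rewrite -[[::]]cats0; apply: weak_path_cat (guest _ _ _ _ vm').
rewrite -[[::]]cats0; apply: weak_path_cat (guest _ _ _ _ mu) _.
by apply: weak_path_tau1; constructor.
Qed.

Lemma ctx_Inf_ev_div : Inf M xi -> ev_div `<=` Inf C.
Proof.
move=> /weak_infinite_path_steps[r r0 rS] x [n0 xD].
(* The prefix has length [n0.+1] because leaving consumes one last action of [L]. *)
have [t [Lt _]] := xD n0.+1 (leqnSn _).
rewrite mkseqS in Lt; have [u [v [Lu uv]]] := weak_path_rcons_inv Lt.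
(* The guest is absent only right after leaving; later it sits at [r j] on its own path along
   [xi]. *)
pose G n (d : state C) := n0 < n /\ exists2 k : option (state M * nat),
  d = (k, (inr false, mkseq x n)) &
  k = None \/ exists j, k = Some (r j, j).
apply: (@weak_infinite_pathI _ C G _ _ n0.+1 _ (None, (inr false, mkseq x n0.+1))).
- move=> n d [n0n [k -> kP]].
  have Dn : Div L (rcons (mkseq x n) (x n)).
    by rewrite -mkseqS; apply: xD; rewrite ltnW // ltnW.
  have [j kj] : exists j, weak_path (L := C) (k, (inr false, mkseq x n)) [::]
      (Some (r j, j), (inr true, mkseq x n)).
    case: kP => [->|[j ->]].
      by exists 0; apply: weak_path_tau1; rewrite r0; constructor.
    have [m rm mr] := rS j; exists j.+1.
    exact: ctx_tick_path (weak_path_step rm mr) _.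
  exists (Some (r j, j), (inr false, mkseq x n.+1)).
    by apply: (weak_path_step kj); rewrite mkseqS; constructor.
  split; first exact: ltnW.
  by eexists; first by []; right; exists j.
- rewrite !mkseqS -cats1; apply: (@weak_path_cat _ C _ (None, (inl u, mkseq x n0))).
    exact: (ctx_lift [::] Lu).
  rewrite cats1; apply: weak_path_vis1; apply: ctx_leave uv _.
  by rewrite -mkseqS; exact: xD.
- by split=> //; eexists; first by []; left.
Qed.

(** No invisible step resets the phase, so at most one tick occurs between visible actions; [b]
    tells whether it did, and the guest makes [b] actions. *)
Lemma ctx_tau_inr (d d' : state C) m j ph sigma :
  weak_path d [::] d' -> d = (Some (m, j), (inr ph, sigma)) ->
  exists m' ph', let b := ph' && ~~ ph in
    [/\ d' = (Some (m', j + b), (inr ph', sigma)),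
        weak_path m (nseq b (xi j)) m' & ph -> ph'].
Proof.
move E : [::] => r dd' dE.
elim: dd' m j ph dE E => [d0 m j ph -> _|d0 v rho w dv _ IH m j ph dE E|//].
  by exists m, ph; rewrite andbN /= addn0; split=> //; exact: weak_nil.
rewrite dE in dv.
inversion dv as [| | | |? ? m1 ? mm1| |? ? m1 ? mm1|]; subst.
- have [m' [ph' [-> mm' ph1]]] := IH _ _ _ erefl erefl.
  rewrite (ph1 isT) /= in mm' *; exists m', true; rewrite addn0 addn1; split=> //.
  exact: weak_vis mm1 mm'.
- have [m' [ph' [-> mm' ph1]]] := IH _ _ _ erefl erefl.
  exists m', ph'; split=> //; exact: weak_tau mm1 mm'.
- exact: IH.
Qed.

Lemma ctx_vis_inr (d d' : state C) a b : trans d (Some a) d' -> d'.2.1 = inr b ->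
  (exists s, d.2.1 = inl s) \/ exists k rho,
    d = (k, (inr true, rho)) /\ d' = (k, (inr false, rcons rho a)).
Proof.
move=> dd'; inversion dd' as [|? ? ? ? ? ?|? s ? ? ? ? ?| | |k ? rho ?| |]; subst => //= _.
  by left; exists s.
by right; exists k, rho.
Qed.

(** A path that never leaves [L] projects to [L]. Otherwise it stays outside from some point on,
    where all prefixes diverge and each further visible action forces a guest step, so the guest
    completes [xi]. *)
Lemma ctx_InfE x : Inf C x -> Inf L x \/ ev_div x /\ Inf M xi.
Proof.
move=> /weak_infinite_path_steps[q q0 qS].
have path n : weak_path (init C) (mkseq x n) (q n).
  elim: n => [|n IH]; first by rewrite q0; exact: weak_nil.
  have [d qd dq] := qS n; rewrite mkseqS -cats1.
  exact: weak_path_cat IH (weak_path_step qd dq).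
have inv n := ctx_inv_path (path n).
have [[n0 [ph nP]]|nN] := pselect (exists n ph, (q n).2.1 = inr ph); last first.
  left.
  have qE n : exists2 s, (q n).2.1 = inl s & (q n).1 = None.
    have [_ + _] := inv n; case E : (q n).2.1 => [s|b].
      by case=> qN _; exists s.
    by case: nN; exists n, b.
  pose p n := if (q n).2.1 is inl s then s else init L.
  apply: (@weak_infinite_pathI _ L (fun n s => s = p n) _ _ 0 _ (init L)).
  - move=> n _ ->; exists (p n.+1) => //; have [d qd dq] := qS n.
    have [t tE tN] := qE n.+1; rewrite /p tE.
    by have [_ [s -> ?]] := ctx_proj (weak_path_step qd dq) tN tE.
  - exact: weak_nil.
  - by rewrite /p q0.
right.
have later n : n0 <= n -> exists b, (q n).2.1 = inr b.
  elim: n => [|n IH]; first by rewrite leqn0 => /eqP E; exists ph; rewrite -E.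
  rewrite leq_eqVlt => /predU1P[E|/IH[b qb]]; first by exists ph; rewrite -E.
  have [d qd dq] := qS n; case E : (q n.+1).2.1 => [s|b']; last by exists b'.
  have [_ + _] := inv n.+1; rewrite E => -[qN _].
  by have [_ [s']] := ctx_proj (weak_path_step qd dq) qN E; rewrite qb.
split; first by exists n0 => i /later[b qb]; have [_] := inv i; rewrite qb => -[].
(* The guest may be unstarted in [q n0], but a visible action outside [L] needs phase [true], hence
   a started guest; thus the index [n.+1]. *)
have strict n : n0 <= n -> exists m j, q n.+1 = (Some (m, j), (inr false, mkseq x n.+1)).
  move=> n0n; have [d qd dq] := qS n; have [b qb] := later n n0n.
  have [_ + _] := ctx_inv_path (weak_path_cat (path n) qd).
  have [b' qb'] := later n.+1 (leqW n0n).
  case: (ctx_vis_inr dq qb') => [[s dE]|[k [rho [dE ->]]]]; rewrite dE.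
    case=> kN _; have [_ [s']] := ctx_proj qd kN dE.
    by rewrite qb.
  move=> [_ kN]; have := ctx_inv_path (weak_path_cat (path n) qd).
  rewrite cats0 dE; case=> /= -> _ _.
  case: k kN {dE} => [[m j] _|[]//]; exists m, j; by rewrite mkseqS.
have [m0 [j0 q0E]] := strict n0 (leqnn _).
pose G j m := exists2 n, n0 <= n & q n.+1 = (Some (m, j), (inr false, mkseq x n.+1)).
(* The invariant supplies the first [j0] actions of [xi] in [M]; the remaining ones come from the
   ticks. *)
have [_ _ /(_ m0 j0)] := inv n0.+1; rewrite q0E => /(_ erefl) Mm0.
apply: (@weak_infinite_pathI _ M G _ _ _ _ _ Mm0); last by exists n0.
move=> j m [n n0n qn]; have [d qd dq] := qS n.+1.
have [m' [ph' [dE mm' _]]] := ctx_tau_inr qd qn.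
(* The visible action requires [ph'] to be [true], so exactly one tick was made. *)
rewrite dE in dq; move: dq.
have [m1 [j1 qE]] := strict n.+1 (leqW n0n).
rewrite qE => dq; inversion dq; subst; exists m1 => //.
by exists n.+1; [exact: leqW | rewrite qE /= addn1].
Qed.

Lemma ctx_Inf_guest : Inf M xi -> Inf C = Inf L `|` ev_div.
Proof.
move=> Mxi; apply/seteqP; split=> [x /ctx_InfE[|[]]|x [|]]; [by left|by right| |].
  exact: ctx_InfI.
exact: ctx_Inf_ev_div.
Qed.

Lemma ctx_Inf_noguest : ~ Inf M xi -> Inf C = Inf L.
Proof.
move=> Mxi; apply/seteqP; split=> [x /ctx_InfE[//|[_ /Mxi//]]|].
exact: ctx_InfI.
Qed.

End ContextSemantics.

(** * Absorption of the eventually divergent infinite traces *)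

Section Absorption.
Variables (Act : Type) (R : LTS Act -> LTS Act -> Prop) (xi : nat -> Act).
Variables M1 M2 : LTS Act.
Hypotheses (Rcong : congruence R) (RM : R M1 M2) (M12 : alph M1 = alph M2).
Hypotheses (xi1 : Inf M1 xi) (xi2 : ~ Inf M2 xi).
Hypothesis Act_infinite : infinite_set [set: Act].
Hypothesis RCFFD : forall L L' : LTS Act, CFFD_equiv L L' -> R L L'.

(** Hilbert's hotel: [g] shifts an embedded copy [f] of the naturals by one and fixes everything
    else, which frees [f 0]. *)
Lemma fresh_action : exists (phi : Act -> Act) (c : Act),
  injective phi /\ forall a, phi a <> c.
Proof.
have /infiniteP/card_leP/unsquash h := Act_infinite.
pose f (n : nat) : Act := val (h (SigSub (mem_set (I : [set: nat] n)))).
have fI : injective f.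
  by move=> m n /val_inj /(@inj _ _ _ h); rewrite !in_setT => /(_ isT isT) [].
have /choice[g gP] : forall a, exists b,
    (exists2 n, a = f n & b = f n.+1) \/ (forall n, a <> f n) /\ b = a.
  move=> a.
  have [[n an]|na] := pselect (exists n, a = f n).
    by exists (f n.+1); left; exists n.
  by exists a; right; split=> // n an; apply: na; exists n.
exists g, (f 0); split=> [a b|a]; last first.
  by case: (gP a) => [[n _ ->]|[na ->]]; [move/fI | exact: na].
case: (gP a) => [[n -> ->]|[na ->]]; case: (gP b) => [[m -> ->]|[mb ->]] //.
- by move=> /fI[->].
- by move=> /esym/mb.
- by move=> /na.
Qed.

(** With the guest [M2], which cannot perform [xi], the context is CFFD-equivalent to [L];
    exchanging [M2] for [M1] is an instance of congruence. *)
Lemma R_ctx L : R L (ctx xi L M1).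
Proof.
have [/= _ sR tR] := congruence_equiv Rcong.
have [phi [c [phi_inj phi_c]]] := fresh_action.
have M1xi n : alph M1 (xi n).
  have [p [l [k [_ pS _ lk _]]]] := xi1.
  by have := pS (k n); rewrite lk => st; exact: trans_alph st.
have M2xi n : alph M2 (xi n) by rewrite -M12.
apply: (tR _ (ctx xi L M2)).
  by apply: RCFFD; split; rewrite ?ctx_Sf ?ctx_Div ?ctx_Inf_noguest.
apply: sR.
rewrite -(contextE phi_inj phi_c L M1xi) -(contextE phi_inj phi_c L M2xi).
apply: congruence_rename => //; apply: congruence_hide => //.
apply: congruence_parl => //; apply: congruence_prefix => //.
apply: congruence_rename => //; exact: congruence_parl.
Qed.

Lemma R_of_aenI L L' : alph L = alph L' -> Sf L = Sf L' -> Div L = Div L' ->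
  aenI L = aenI L' -> R L L'.
Proof.
have [/= _ sR tR] := congruence_equiv Rcong.
move=> eA eS eD eI; apply: (tR _ _ _ (R_ctx L)); apply: (tR _ (ctx xi L' M1)); last first.
  exact: sR (R_ctx L').
apply: RCFFD; split; rewrite ?ctx_Sf ?ctx_Div ?ctx_Inf_guest //.
(* A member of [Inf K] outside [ev_div K] has non-divergent prefixes of arbitrary length, so it is
   in [aenI K]. *)
have aenIU K : Inf K `|` ev_div K = aenI K `|` ev_div K.
  apply/seteqP; split=> x [Kx|]; [|by right|left; exact: Kx.1|by right].
  have [|nx] := pselect (ev_div K x); first by right.
  left; split=> // n; apply: contrapT => nD; apply: nx; exists n => i ni.
  by apply: contrapT => Di; apply: nD; exists i.
by rewrite !aenIU eI /ev_div eD.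
Qed.

End Absorption.

Theorem theorem6p18 (Act : Type) (Act_infinite : infinite_set [set: Act]%classic)
    (R : LTS Act -> LTS Act -> Prop) :
  congruence R ->
  (forall L L' : LTS Act, CFFD_equiv L L' -> R L L') ->
  preserves R (@Sf Act) ->
  preserves R (@Div Act) ->
  preserves R (@aenI Act) ->
  ~ preserves R (@Inf Act) ->
  forall L L' : LTS Act,
    R L L' <->
    [/\ alph L = alph L', Sf L = Sf L', Div L = Div L' & aenI L = aenI L'].
Proof.
move=> Rcong RCFFD RSf RDiv RaenI RInf L L'.
have Ralph := alph_preserved Rcong RSf RDiv.
split=> [RL|[eA eS eD eI]].
  by split; [exact: Ralph|exact: RSf|exact: RDiv|exact: RaenI].
have [M1 [M2 [xi [RM xi1 xi2]]]] : exists M1 M2 xi,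
    [/\ R M1 M2, Inf M1 xi & ~ Inf M2 xi].
  have [/= _ sR _] := congruence_equiv Rcong.
  apply: contrapT => nM; apply: RInf => M1 M2 RM.
  (* Either inclusion may fail; by symmetry of [R] the system that has [xi] can be put first. *)
  apply/seteqP; split=> xi Mxi; apply: contrapT => nxi; apply: nM.
    by exists M1, M2, xi.
  by exists M2, M1, xi; split=> //; exact: sR.
exact: (R_of_aenI Rcong RM (Ralph _ _ RM) xi1 xi2).
Qed.
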